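(* Let $\kappa\ge2$, $n\ge1$ be integers and $0<\epsilon<1$. Let $\check q$ be the first subspace exclusion code vector: $\check q_i=0$ for $0\le i<2^{\kappa-1}$ and $\check q_i=2^{1-\kappa}$ for $2^{\kappa-1}\le i\le 2^\kappa-1$. Let $\mathcal{C}_{\rho}$ be the set of $q\in\mathbb{R}^{2^\kappa}$ with $q_0=0$, $q_i\ge0$ for all $i$, $\sum_i q_i=1$, and $\Big(\sum_{i=1}^{2^\kappa-1}\big(q_i-\tfrac{1}{2^\kappa-1}\big)^2\Big)^{1/2}=\sqrt{\frac{2^{\kappa-1}-1}{(2^\kappa-2^{\kappa-1})(2^\kappa-1)}}.$ Then $\check q\in\mathcal{C}_\rho$ and $\check q$ is a local minimizer of $q\mapsto l(n,\epsilon,q)$ on $\mathcal{C}_\rho$.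
   Context: $W=\mathbb{F}_2^\kappa$; $\nu(i)\in W$ is the binary expansion of $i\in\{0,\dots,2^\kappa-1\}$ (so $\{\nu(i):i<2^{\kappa-1}\}$ is a $(\kappa-1)$-dimensional subspace); vectors $q\in\mathbb{R}^{2^\kappa}$ are indexed $q_0,\dots,q_{2^\kappa-1}$. For a subspace $S\subseteq W$, $\zeta(S,q)=\sum_{i:\nu(i)\in S}q_i$; $\Xi(W,d)$ is the set of $d$-dimensional subspaces of $W$. For real $q$, the (continuous) expected equivocation loss is $l(n,\epsilon,q)=n(1-\epsilon)-\kappa+\sum_{\delta=1}^{\kappa}K_\delta\sum_{S\in\Xi(W,\kappa-\delta)}\epsilon^{n(1-\zeta(S,q))}$, with $K_\delta=\prod_{i=1}^{\delta-1}(1-2^i)$. The radius condition says that $(q_1,\dots,q_{2^\kappa-1})$ lies at the same Euclidean distance from the uniform vector $(\frac{1}{2^\kappa-1},\dots)$ as $(\check q_1,\dots,\check q_{2^\kappa-1})$ does. A local minimizer of $f$ on a set $\mathcal{C}$ is a point $q\in\mathcal{C}$ with $f(q)\le f(q')$ for all $q'\in\mathcal{C}$ in some neighborhood of $q$. *)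

(* Defs.v *)
From HB Require Import structures.
From mathcomp Require Import all_boot all_order all_algebra.
From mathcomp Require Import all_classical all_reals all_analysis.
Set Implicit Arguments. Unset Strict Implicit. Unset Printing Implicit Defensive.
Import Order.TTheory GRing.Theory Num.Theory.
Local Open Scope ring_scope.

Definition nu (k i : nat) : 'rV['F_2]_k := \row_(j < k) ((odd (i %/ 2 ^ j))%:R).

(* d-dimensional subspaces of W, as sets: row spaces of rank-d matrices. *)
Definition Xi (k d : nat) : {set {set 'rV['F_2]_k}} :=
  [set S | [exists A : 'M['F_2]_k,
              (\rank A == d)%N && (S == [set v | (v <= A)%MS])]].

Section Loss.
Variable R : realType.

Definition zeta (k : nat) (S : {set 'rV['F_2]_k}) (q : 'I_(2 ^ k) -> R) : R :=
  \sum_(i < 2 ^ k | nu k i \in S) q i.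

Definition Kc (d : nat) : R := \prod_(1 <= i < d) (1 - 2%:R ^+ i).

Definition loss (k n : nat) (eps : R) (q : 'I_(2 ^ k) -> R) : R :=
  n%:R * (1 - eps) - k%:R
  + \sum_(1 <= d < k.+1)
      Kc d * \sum_(S in Xi k (k - d)) eps `^ (n%:R * (1 - zeta S q)).

Definition qcheck (k : nat) : 'I_(2 ^ k) -> R :=
  fun i => if (val i < 2 ^ (k - 1))%N then 0 else (2%:R ^+ (k - 1))^-1.

Definition Crho (k : nat) (q : 'I_(2 ^ k) -> R) : Prop :=
  [/\ (forall i : 'I_(2 ^ k), val i = 0%N -> q i = 0),
      (forall i, 0 <= q i),
      \sum_(i < 2 ^ k) q i = 1 &
      Num.sqrt (\sum_(i < 2 ^ k | (0 < val i)%N)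
                  (q i - (2%:R ^+ k - 1)^-1) ^+ 2)
      = Num.sqrt ((2%:R ^+ (k - 1) - 1)
                  / ((2%:R ^+ k - 2%:R ^+ (k - 1)) * (2%:R ^+ k - 1)))].

Definition local_minimizer (m : nat) (f : ('I_m -> R) -> R)
  (C : ('I_m -> R) -> Prop) (q : 'I_m -> R) : Prop :=
  C q /\ exists2 e : R, 0 < e &
    forall q', C q' -> (forall i, `|q' i - q i| < e) -> f q <= f q'.
End Loss.

(* Main.v *)
(** Let [H] be the hyperplane of the vectors with last coordinate [0], put
    [M = 2 ^ (k - 1)], [h = q - qcheck] and [a = - n ln eps].  The sphere
    equation says that the mass [t] of [h] on [H] is [(M / 2) |h|^2], so [h] is
    of second order on [H] and the loss has to be expanded to second order in
    the other coordinates.  Writing [alpha] (resp. [beta]) for the sum of the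
    weights [Kc d * exp (a zeta (S, qcheck))] over the subspaces [S] through a
    vector outside [H] (resp. a nonzero vector of [H]), and [gamma] for the sum
    over the [S] through two vectors outside [H], the expansion is
    [t (a (beta - alpha) + (a^2 / M) (alpha - gamma)) + o(t)] up to a positive
    factor.  Counting subspaces by Gaussian binomials, the bracket becomes, with
    [N = k - 2],
    [a sum_j (prod_(i < j) (1 - 2^(N - i))) g (a / 2^(j + 1))] where
    [g y = 1 - e^y + y e^y].  The power series of [g] has nonnegative
    coefficients, and the polynomials
    [P_N z = sum_j (prod_(i < j) (1 - 2^(N - i))) z^j] are positive at
    [z = 2^-m], [m >= 1], because of
    [P_(N+1) z = 1 - z (2^(N+1) - 1) P_N z] and
    [2^N z P_N (z / 2) = 1 - (1 - z) P_N z]. *)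

Require Import Defs.
From HB Require Import structures.
From mathcomp Require Import all_boot all_order all_algebra.
From mathcomp Require Import all_classical all_reals all_analysis.
From mathcomp Require Import mxabelem.
From mathcomp Require Import ring lra zify.
Import Order.TTheory GRing.Theory Num.Theory.
Import numFieldNormedType.Exports.
Local Open Scope ring_scope.

(** * Gaussian binomials at base 2 *)

Section GaussianBinomials.
Variable F : numFieldType.

(** The Gaussian binomial coefficient. For r > m the factor i = m is 2^0 - 1, so the value is 0. *)
Definition gbin (m r : nat) : F :=
  \prod_(i < r) ((2%:R ^+ (m - i) - 1) / (2%:R ^+ i.+1 - 1)).

Lemma expr2S_sub1_neq0 r : 2%:R ^+ r.+1 - 1 != 0 :> F.
Proof. by rewrite subr_eq0 gt_eqF // exprn_egt1 // ltr1n. Qed.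

Lemma gbin0 m : gbin m 0 = 1.
Proof. by rewrite /gbin big_ord0. Qed.

Lemma gbin_recr m r :
  gbin m r.+1 * (2%:R ^+ r.+1 - 1) = gbin m r * (2%:R ^+ (m - r) - 1).
Proof.
by rewrite /gbin big_ord_recr /= -mulrA mulfVK // expr2S_sub1_neq0.
Qed.

Lemma gbin_recl m r :
  gbin m.+1 r.+1 * (2%:R ^+ r.+1 - 1) = gbin m r * (2%:R ^+ m.+1 - 1).
Proof.
rewrite /gbin !big_split /= big_ord_recl /= subn0.
rewrite [\prod_(i < r.+1) _]big_ord_recr /=.
under eq_bigr do rewrite subSS.
rewrite -!mulrA mulVf ?expr2S_sub1_neq0 // mulr1.
by ring.
Qed.

(** A q-Pascal rule. Multiplied by 2^(r+1) - 1, both sides reduce to [gbin m r] by the two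
    recurrences, and m+1 = (r+1) + (m-r) splits the power. *)
Lemma gbin_pascal m r : (r <= m)%N ->
  gbin m.+1 r.+1 - gbin m r = 2%:R ^+ r.+1 * gbin m r.+1.
Proof.
move=> rm; apply: (mulIf (expr2S_sub1_neq0 r)).
rewrite mulrBl gbin_recl -mulrA gbin_recr.
have -> : m.+1 = (r.+1 + (m - r))%N by rewrite addSn subnKC.
by rewrite exprD; ring.
Qed.

Lemma gbinn m : gbin m m = 1.
Proof.
elim: m => [|m IH]; first exact: gbin0.
by apply: (mulIf (expr2S_sub1_neq0 m)); rewrite gbin_recl IH.
Qed.

End GaussianBinomials.

(** * Alternating polynomials and their positivity at negative powers of 2 *)

Section AlternatingPolynomials.
Variable R : realType.

Definition qpoch (N j : nat) : R := \prod_(i < j) (1 - 2%:R ^+ (N - i)).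

(** By symmetry [gbin R N (N - j)] is the product over i < j of (2^(N-i) - 1) / (2^(i+1) - 1). [Kc]
    cancels the denominators up to (-1)^j, and this sign flips the numerators. The induction steps
    through [gbin_recr] instead of proving the symmetry. *)
Lemma Kc_gbin N j : (j <= N)%N -> Kc R j.+1 * gbin R N (N - j) = qpoch N j.
Proof.
elim: j => [|j IH] jN.
  by rewrite subn0 gbinn /qpoch big_ord0 /Kc big_geq // mulr1.
rewrite /qpoch big_ord_recr /= -[\prod_(_ < _) _]/(qpoch N j) -IH; last exact: ltnW.
rewrite /Kc big_nat_recr //= -!/(Kc R _).
have E : (N - j = (N - j.+1).+1)%N by rewrite subnS prednK // subn_gt0.
have := gbin_recr R N (N - j.+1).
rewrite -E (_ : N - (N - j.+1) = j.+1)%N; last by rewrite subKn.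
set A := gbin R N (N - j); set B := gbin R _ _; move=> H.
rewrite -/(Kc R j.+1) -mulrA.
have -> : (1 - 2%:R ^+ j.+1) * B = A * (1 - 2%:R ^+ (N - j)).
  by apply: oppr_inj; rewrite -mulNr opprB mulrC -H; ring.
by rewrite mulrA.
Qed.

Definition qpoly (N : nat) (z : R) : R := \sum_(j < N.+1) qpoch N j * z ^+ j.

Lemma qpoly_rec N z :
  qpoly N.+1 z = 1 - z * (2%:R ^+ N.+1 - 1) * qpoly N z.
Proof.
rewrite /qpoly big_ord_recl /= /qpoch big_ord0 expr0 mulr1.
rewrite mulr_sumr -sumrN; congr (_ + _); apply: eq_bigr => i _.
rewrite /bump /= add1n big_ord_recl /= subn0.
under eq_bigr do rewrite subSS.
by rewrite [z ^+ i.+1]exprS; ring.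
Qed.

(* Together with [qpoly_rec], this propagates positivity from [z] to [z / 2]. *)
Lemma qpoly_half N z :
  2%:R ^+ N * z * qpoly N (z / 2%:R) = 1 - (1 - z) * qpoly N z.
Proof.
elim: N => [|N IH].
  by rewrite /qpoly !big_ord1 /qpoch !big_ord0 !expr0; ring.
rewrite !qpoly_rec.
have -> : 2%:R ^+ N.+1 * z *
    (1 - z / 2%:R * (2%:R ^+ N.+1 - 1) * qpoly N (z / 2%:R)) =
  2%:R ^+ N.+1 * z - z * (2%:R ^+ N.+1 - 1) *
    (2%:R ^+ N * z * qpoly N (z / 2%:R)).
  by rewrite exprS; field.
by rewrite IH; ring.
Qed.

(** Induction on m for all N at once. At z = 1, [qpoly_half] reads 2^N P_N(1/2) = 1. At z =
    2^-(m+1), positivity for every N and [qpoly_rec] give P_N z <= 1, so (1 - z) P_N z < 1, and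
    [qpoly_half] yields positivity at z/2. *)
Lemma qpoly_half_gt0 m N : 0 < qpoly N (2%:R^-1 ^+ m.+1).
Proof.
elim: m N => [|m IH] N.
  have := qpoly_half N 1; rewrite subrr mul0r subr0 mulr1 mul1r expr1 => H.
  by rewrite -(pmulr_rgt0 _ (exprn_gt0 N (ltr0n R 2))) H.
have z0 : 0 < 2%:R^-1 ^+ m.+1 :> R by rewrite exprn_gt0 // invr_gt0 ltr0n.
have z1 : 2%:R^-1 ^+ m.+1 <= 1 :> R.
  by rewrite exprn_ile1 // ?invr_ge0 ?ler0n // invf_le1 ?ler1n ?ltr0n.
have q1 : qpoly N (2%:R^-1 ^+ m.+1) <= 1.
  case: N => [|N]; first by rewrite /qpoly big_ord1 /qpoch big_ord0 mulr1.
  rewrite qpoly_rec gerBl mulr_ge0 // ?mulr_ge0 ?ltW //.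
  by rewrite subr_gt0 exprn_egt1 // ltr1n.
rewrite exprSr.
rewrite -(pmulr_rgt0 _ (mulr_gt0 (exprn_gt0 N (ltr0n R 2)) z0)) qpoly_half.
by rewrite subr_gt0; have := IH N; nra.
Qed.

End AlternatingPolynomials.

(** * Power series estimates for the exponential *)

Section ExponentialSeries.
Variable R : realType.
Implicit Types u y : R.

Lemma series_exp_coeffE u n :
  series (exp_coeff u) n = \sum_(i < n) u ^+ i / i`!%:R.
Proof. by rewrite /series /= big_mkord. Qed.

Lemma cvg_exp_series u :
  ((fun n => series (exp_coeff u) n) @ \oo --> expR u)%classic.
Proof. exact: is_cvg_series_exp_coeff. Qed.

(** Since i! <= (3+i)!, the tail is dominated term by term by |u|^3 times the series of e^|u|. *)
Lemma expR_taylor2 u : `|expR u - (1 + u + u ^+ 2 / 2%:R)| <= `|u| ^+ 3 * expR `|u|.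
Proof.
have H1 : ((fun n => `|series (exp_coeff u) (n + 3)%N - (1 + u + u ^+ 2 / 2%:R)|)
    @ \oo --> `|expR u - (1 + u + u ^+ 2 / 2%:R)|)%classic.
  apply: cvg_norm; apply: cvgB; last exact: cvg_cst.
  by rewrite (cvg_shiftn 3); exact: cvg_exp_series.
have H2 : ((fun n => `|u| ^+ 3 * series (exp_coeff `|u|) n) @ \oo -->
    `|u| ^+ 3 * expR `|u|)%classic.
  by apply: cvgM; [exact: cvg_cst|exact: cvg_exp_series].
rewrite -(cvg_lim _ H1) // -(cvg_lim _ H2) //.
apply: ler_lim; [exact: cvgP H1|exact: cvgP H2|].
apply: nearW => n; rewrite !series_exp_coeffE addnC.
rewrite big_split_ord /= !big_ord_recl big_ord0 /= /bump /= !fact0 !factS.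
rewrite (_ : _ - _ = \sum_(i < n) u ^+ (3 + i) / (3 + i)`!%:R); last first.
  by rewrite !mul1n ?fact0 ?muln1 addr0 expr0 expr1 !divr1 /=; ring.
apply: le_trans (ler_norm_sum _ _ _) _; rewrite mulr_sumr.
apply: ler_sum => i _; rewrite normrM normrX exprD -mulrA.
rewrite ler_wpM2l ?exprn_ge0 // ler_wpM2l ?exprn_ge0 //.
rewrite normfV normr_nat lef_pV2 ?posrE ?ltr0n ?fact_gt0 // ler_nat.
by apply: leq_fact; rewrite leq_addl.
Qed.

(** Partial sums of g y = 1 - e^y + y e^y. The extra term in the first series aligns the powers of
    y, and 1/m! - 1/(m+1)! = m/(m+1)!. *)
Lemma partial_exp_series_mulB y n :
  1 - series (exp_coeff y) n.+1 + y * series (exp_coeff y) n =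
  \sum_(m < n) m%:R / m.+1`!%:R * y ^+ m.+1.
Proof.
rewrite !series_exp_coeffE big_ord_recl /= expr0 fact0 divr1 opprD addrA subrr.
rewrite add0r -sumrN mulr_sumr -big_split; apply: eq_bigr => i _ /=.
rewrite /bump /= add1n factS natrM exprS.
have f0 : i`!%:R != 0 :> R by rewrite pnatr_eq0 -lt0n fact_gt0.
have i0 : i.+1%:R != 0 :> R by rewrite pnatr_eq0.
by rewrite -natr1 in i0 *; field; rewrite f0 i0.
Qed.

(* Expanding in powers of [a], the coefficient of [a ^+ m] is
   [(m - 1) / m! * 2^-m * qpoly N 2^-m]. *)
Lemma alternating_exp_sum_gt0 N (a : R) : 0 < a ->
  0 < \sum_(j < N.+1) qpoch R N j *
        (1 - expR (a * 2%:R^-1 ^+ j.+1)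
         + a * 2%:R^-1 ^+ j.+1 * expR (a * 2%:R^-1 ^+ j.+1)).
Proof.
move=> a0; pose y (j : nat) : R := a * 2%:R^-1 ^+ j.+1.
pose F n := \sum_(j < N.+1) qpoch R N j *
  (1 - series (exp_coeff (y j)) n.+1 + y j * series (exp_coeff (y j)) n).
pose G m := m%:R / m.+1`!%:R * (a * 2%:R^-1) ^+ m.+1
              * qpoly R N (2%:R^-1 ^+ m.+1).
have G0 m : 0 <= G m.
  rewrite /G mulr_ge0 ?(ltW (qpoly_half_gt0 _ _ _)) // mulr_ge0 ?exprn_ge0 //.
  by rewrite mulr_ge0 ?invr_ge0 // ltW.
have FG n : F n = \sum_(m < n) G m.
  rewrite /F; under eq_bigr do rewrite partial_exp_series_mulB mulr_sumr.
  rewrite exchange_big; apply: eq_bigr => m _.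
  rewrite /G /qpoly mulr_sumr; apply: eq_bigr => j _ /=.
  rewrite /y -!exprM !exprMn -!exprM.
  have -> : (j.+1 * m.+1 = m.+1 + m.+1 * j)%N by rewrite mulSn mulnC.
  by rewrite exprD; ring.
have cF : (F @ \oo --> \sum_(j < N.+1) qpoch R N j *
    (1 - expR (y j) + y j * expR (y j)))%classic.
  rewrite (_ : F = (fun n => F n)) //.
  apply: cvg_big; [exact: add_continuous|move=> j _].
  apply: cvgM; first exact: cvg_cst.
  apply: cvgD.
    apply: cvgB; first exact: cvg_cst.
    by rewrite (cvg_shiftS (series (exp_coeff (y j)))); exact: cvg_exp_series.
  by apply: cvgM; [exact: cvg_cst|exact: cvg_exp_series].
(* [G 0] is 0, so [G 1] is the first term that gives a strict lower bound. *)
rewrite -(cvg_lim _ cF) //; apply: (@lt_le_trans _ _ (G 1%N)).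
  have c0 : 0 < 1%:R / 2`!%:R :> R by rewrite divr_gt0 ?ltr0n.
  have a2 : 0 < a * 2%:R^-1 by rewrite divr_gt0 ?ltr0n.
  exact: mulr_gt0 (mulr_gt0 c0 (exprn_gt0 _ a2)) (qpoly_half_gt0 _ _ _).
apply: limr_ge; first exact: cvgP cF.
exists 2%N => // n /= n2; rewrite FG -(subnKC n2) big_split_ord /=.
rewrite !big_ord_recl big_ord0 addr0 /= /bump /= addn0.
by rewrite addrAC lerDr addr_ge0 ?sumr_ge0.
Qed.

End ExponentialSeries.

(** * Counting subspaces with prescribed members *)

Section SubspaceCounting.
Variable k : nat.
Implicit Types (S : {set 'rV['F_2]_k}).

Lemma XiP d S :
  reflect (exists2 A : 'M['F_2]_k, \rank A = d & S = rowg A) (S \in Xi k d).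
Proof.
rewrite inE; apply: (iffP existsP) => [[A /andP[/eqP rA /eqP ->]]|[A rA ->]];
  by exists A => //; rewrite rA !eqxx.
Qed.

Lemma card_Xi {d S} : S \in Xi k d -> #|S| = (2 ^ d)%N.
Proof. by case/XiP => A <- ->; rewrite card_rowg card_Fp. Qed.

Lemma Xi_subP {d S m} (U : 'M['F_2]_(m, k)) (v : 'rV['F_2]_k) : S \in Xi k d ->
  (rowg (U + v)%MS \subset S) = (rowg U \subset S) && (v \in S).
Proof. by case/XiP => A _ ->; rewrite !rowgS addsmx_sub mem_rowg. Qed.

Lemma mxrank_adds_rV {m} (U : 'M['F_2]_(m, k)) (v : 'rV['F_2]_k) :
  ~~ (v <= U)%MS -> \rank (U + v)%MS = (\rank U).+1.
Proof.
move=> vU; apply/eqP; rewrite eqn_leq; apply/andP; split.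
  apply: leq_trans (mxrank_adds_leqif U v) _.
  by rewrite -[(\rank U).+1]addn1 leq_add2l rank_leq_row.
have : (U < U + v)%MS by rewrite ltmxE addsmxSl /= addsmx_sub submx_refl.
by rewrite ltmxErank => /andP[].
Qed.

Definition Xi_between d {m1 m2} (U : 'M['F_2]_(m1, k)) (V : 'M['F_2]_(m2, k)) :=
  [set S in Xi k d | (rowg U \subset S) && (S \subset rowg V)].

Lemma in_Xi_between d m1 m2 (U : 'M['F_2]_(m1, k)) (V : 'M['F_2]_(m2, k)) S :
  (S \in Xi_between d U V) =
  [&& S \in Xi k d, rowg U \subset S & S \subset rowg V].
Proof. by rewrite finset.in_set. Qed.

(* Double counting of the pairs (v, S) with v in S but not in U. *)
Lemma Xi_between_double_count d {m1 m2} (U : 'M['F_2]_(m1, k))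
    (V : 'M['F_2]_(m2, k)) :
  (\sum_(v in rowg V :\: rowg U) #|Xi_between d (U + v)%MS V| =
   #|Xi_between d U V| * (2 ^ d - 2 ^ \rank U))%N.
Proof.
transitivity (\sum_(v in rowg V :\: rowg U)
    \sum_(S in Xi_between d U V) (v \in S : nat))%N.
  apply: eq_bigr => v _; rewrite -big_mkcondr sum1_card.
  apply: eq_card => S; rewrite [RHS]unfold_in /= !in_Xi_between.
  case: (boolP (S \in Xi k d)) => //= SX.
  by rewrite (Xi_subP _ _ SX) andbAC.
rewrite exchange_big -sum_nat_const; apply: eq_bigr => S.
rewrite in_Xi_between => /and3P[SX US SV].
rewrite -big_mkcondr sum1_card -(card_Xi SX).
have -> : (2 ^ \rank U)%N = #|rowg U| by rewrite card_rowg card_Fp.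
rewrite -{2}(finset.setIidPr US) -cardsD; apply: eq_card => v.
rewrite unfold_in /= !inE; case: (boolP (v \in S)) => [vS|]; rewrite ?andbF //.
by have := fintype.subsetP SV _ vS; rewrite inE => ->; rewrite !andbT.
Qed.

(** Induction on d - rank U. In the double count each of the 2^(rank V) - 2^(rank U) vectors v
    contributes the same number, known by induction for U + v; dividing by 2^d - 2^(rank U) gives
    [gbin_recl]. *)
Lemma card_Xi_between (R : numFieldType) d {m1 m2} (U : 'M['F_2]_(m1, k))
    (V : 'M['F_2]_(m2, k)) : (U <= V)%MS -> (\rank U <= d)%N ->
  #|Xi_between d U V|%:R = gbin R (\rank V - \rank U) (d - \rank U).
Proof.
move Er : (d - \rank U)%N => r; elim: r m1 U Er => [|r IH] m1 U Er UV Ud.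
  rewrite gbin0; have {}Ud : \rank U = d by apply/eqP; rewrite eqn_leq Ud -subn_eq0 Er.
  have -> : Xi_between d U V = [set rowg U]; last by rewrite cards1.
  apply/setP => S; rewrite in_Xi_between finset.in_set1.
  apply/and3P/eqP => [[SX US SV]|->]; last first.
    split; rewrite ?rowgS //; apply/XiP; exists <<U>>%MS.
      by rewrite mxrank_gen.
    by apply: eq_rowg; apply: eqmx_sym; apply: genmxE.
  by apply/eqP; rewrite eq_sym eqEcard US card_rowg card_Fp // (card_Xi SX) Ud /=.
have dE : d = (\rank U + r.+1)%N by rewrite -Er subnKC.
have rUV := mxrankS UV.
have p2 n : (2 ^ n)%:R = 2%:R ^+ n :> R by rewrite natrX.
have := Xi_between_double_count d U V => /(congr1 (fun x => x%:R : R)).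
rewrite natrM natrB ?leq_exp2l //.
rewrite natr_sum (eq_bigr (fun=> gbin R (\rank V - \rank U).-1 r)); last first.
  move=> v; rewrite !inE => /andP[vU vV].
  have rv := mxrank_adds_rV U v vU.
  rewrite IH ?rv ?addsmx_sub ?UV //.
  - by rewrite subnS.
  - by rewrite subnS Er.
  - by rewrite dE addnS ltnS leq_addr.
rewrite sumr_const -[gbin _ _ _ *+ _]mulr_natl cardsD (finset.setIidPr _) ?rowgS // !card_rowg card_Fp //.
rewrite natrB ?leq_exp2l // !p2.
rewrite -(subnKC rUV) addKn dE !exprD.
set u := 2%:R ^+ \rank U; have u0 : u != 0 by rewrite expf_neq0 // pnatr_eq0.
move: (\rank V - \rank U)%N => c H.
have u1 : 2%:R ^+ r.+1 - 1 != 0 :> R by apply: expr2S_sub1_neq0.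
apply: (mulIf (mulf_neq0 u0 u1)).
transitivity (#|Xi_between d U V|%:R * (u * 2%:R ^+ r.+1 - u)); first by rewrite dE; ring.
(* If c = 0 there is no vector to add, and both sides vanish whatever the truncated c - 1 gives. *)
rewrite dE -H; case: c {H} => [|c] /=.
  by rewrite /gbin big_ord_recl /= subn0 expr0; ring.
rewrite -[RHS](_ : u * (gbin R c.+1 r.+1 * (2%:R ^+ r.+1 - 1)) = _); last by ring.
by rewrite gbin_recl; ring.
Qed.

(** The linear form [e] has rank 1 on S, so S meets its kernel in dimension d - 1, and 2^d - 2^(d-1)
    = 2^(d-1). *)
Lemma card_Xi_setD_hyperplane d S (e : 'cV['F_2]_k) : S \in Xi k d ->
  ~~ (S \subset rowg (kermx e)) -> #|S :\: rowg (kermx e)| = (2 ^ d.-1)%N.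
Proof.
case/XiP => A rA ->; rewrite rowgS => /sub_kermxP /eqP Ae.
have : \rank (A *m e) = 1%N.
  apply/eqP; rewrite eqn_leq rank_leq_col lt0n mxrank_eq0. exact: Ae.
have -> : rowg A :\: rowg (kermx e) = rowg A :\: rowg (A :&: kermx e)%MS.
  apply/setP => v; rewrite !inE sub_capmx.
  by case: (v <= A)%MS; rewrite ?andbF.
rewrite cardsD (finset.setIidPr _) ?rowgS ?capmxSl // !card_rowg card_Fp //.
have := mxrank_mul_ker A e; rewrite rA => <- ->.
by rewrite add1n /= expnS mul2n -addnn addnK.
Qed.

Lemma card_Xi_mem_sub (R : numFieldType) d m (v : 'rV['F_2]_k)
    (V : 'M['F_2]_(m, k)) : v != 0 -> (v <= V)%MS -> (0 < d)%N ->
  #|[set S in Xi k d | (v \in S) && (S \subset rowg V)]|%:R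
    = gbin R (\rank V).-1 d.-1.
Proof.
move=> v0 vV d0; have rv : \rank v = 1%N by rewrite rank_rV v0.
have := card_Xi_between R d v V vV; rewrite rv !subn1 => <- //.
congr (_%:R); apply: eq_card => S; rewrite in_Xi_between finset.in_set.
case: (boolP (S \in Xi k d)) => //= /XiP[A _ ->].
by rewrite !rowgS mem_rowg.
Qed.

Lemma card_Xi_mem (R : numFieldType) d (v : 'rV['F_2]_k) :
  v != 0 -> (0 < d)%N -> #|[set S in Xi k d | v \in S]|%:R = gbin R k.-1 d.-1.
Proof.
move=> v0 d0; have := card_Xi_mem_sub R d k v 1%:M v0 (submx1 _) d0.
rewrite mxrank1 => <-; congr (_%:R); apply: eq_card => S.
by rewrite !finset.in_set rowg1 finset.subsetT andbT.
Qed.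

(** Over F_2 the only multiples of a vector are 0 and itself. *)
Lemma mxrank_adds_distinct (v v' : 'rV['F_2]_k) :
  v != 0 -> v' != 0 -> v != v' -> \rank (v + v')%MS = 2%N.
Proof.
move=> v0 v0' vv'; rewrite mxrank_adds_rV ?rank_rV ?v0 //.
apply/negP => /sub_rVP[c cE].
have /orP[/eqP c0|/eqP c1] : (c == 0) || (c == 1) by case: c {cE} => [[|[|]]].
  by rewrite cE c0 scale0r eqxx in v0'.
by rewrite cE c1 scale1r eqxx in vv'.
Qed.

(** The case split matters at d = 1: truncated subtraction would make the binomial 1, but no line
    contains two distinct nonzero vectors. *)
Lemma card_Xi_mem2 (R : numFieldType) d (v v' : 'rV['F_2]_k) :
  v != 0 -> v' != 0 -> v != v' ->
  #|[set S in Xi k d | (v \in S) && (v' \in S)]|%:R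
    = if (1 < d)%N then gbin R (k - 2) (d - 2) else 0.
Proof.
move=> v0 v0' vv'; have rvv' := mxrank_adds_distinct _ _ v0 v0' vv'.
have vvS S : S \in Xi k d ->
    (v \in S) && (v' \in S) = (rowg (v + v')%MS \subset S).
  by case/XiP => A _ ->; rewrite rowgS addsmx_sub !mem_rowg.
case: ifPn => [d2|d2].
  have := card_Xi_between R d (v + v')%MS (1%:M : 'M['F_2]_k) (submx1 _).
  rewrite mxrank1 rvv' => <- //; congr (_%:R); apply: eq_card => S.
  rewrite in_Xi_between finset.in_set rowg1 finset.subsetT andbT.
  by case: (boolP (S \in Xi k d)) => //= /vvS.
apply/eqP; rewrite pnatr_eq0 cards_eq0; apply/eqP/setP => S.
rewrite finset.in_set finset.in_set0; apply/negP => /andP[SX].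
rewrite (vvS _ SX); case/XiP: SX => A rA ->; rewrite rowgS => /mxrankS.
by rewrite rvv' rA; apply/negP.
Qed.

End SubspaceCounting.

(** * A second-order criterion for weighted exponential sums *)

Section SecondOrderMinimum.
Variables (R : realType) (I J : finType).

Lemma sqr_sum_le (h : I -> R) : (\sum_i h i) ^+ 2 <= #|I|%:R * \sum_i h i ^+ 2.
Proof.
rewrite expr2 mulr_suml.
apply: (@le_trans _ _ (\sum_i \sum_j ((h i ^+ 2 + h j ^+ 2) / 2%:R))).
  apply: ler_sum => i _; rewrite mulr_sumr; apply: ler_sum => j _.
  by have := sqr_ge0 (h i - h j); lra.
have -> : \sum_i \sum_j ((h i ^+ 2 + h j ^+ 2) / 2%:R)
    = #|I|%:R * \sum_i h i ^+ 2; last exact: lexx.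
under eq_bigr do rewrite -mulr_suml big_split /= sumr_const.
rewrite -mulr_suml big_split /= sumr_const sumrMnl.
by field.
Qed.

(** In the application [J] consists of the sets of vectors, [I] of the coordinate indices, [b] is
    incidence, [A] selects the vectors outside the hyperplane, and [i0] below is the index of the
    zero vector. *)
Variables (b : J -> I -> R) (w : J -> R) (A : pred I).
Hypothesis b01 : forall j i, 0 <= b j i <= 1.

Lemma norm_sum_indicator_le (h : I -> R) (P : pred I) j e :
  (forall i, `|h i| <= e) -> `|\sum_(i | P i) b j i * h i| <= #|I|%:R * e.
Proof.
move=> he; apply: le_trans (ler_norm_sum _ _ _) _.
rewrite big_mkcond mulr_natl -sumr_const; apply: ler_sum => i _.
have /andP[b0 b1] := b01 j i; have := he i; have := normr_ge0 (h i).
case: (P i) => h0 hi; last exact: le_trans h0 hi.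
rewrite normrM (ger0_norm b0); nra.
Qed.

Variables (alpha beta gamma a mu : R) (i0 : I).
Hypothesis alphaE : forall i, A i -> \sum_j w j * b j i = alpha.
Hypothesis betaE : forall i, ~~ A i -> i != i0 -> \sum_j w j * b j i = beta.
Hypothesis gammaE : forall i i', A i -> A i' ->
  \sum_j w j * (b j i * b j i') = if i == i' then alpha else gamma.

Lemma first_order_sum (h : I -> R) : h i0 = 0 ->
  \sum_j w j * (\sum_i b j i * h i) =
  alpha * (\sum_(i | A i) h i) + beta * (\sum_(i | ~~ A i) h i).
Proof.
move=> h0; under eq_bigr do rewrite mulr_sumr.
rewrite exchange_big (bigID A) /= !mulr_sumr; congr (_ + _).
  apply: eq_bigr => i Ai; rewrite -(alphaE _ Ai) mulr_suml.
  by apply: eq_bigr => j _; rewrite mulrA.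
apply: eq_bigr => i Ai; have [->|ii0] := eqVneq i i0.
  by rewrite h0 mulr0 big1 // => j _; rewrite !mulr0.
rewrite -(betaE _ Ai ii0) mulr_suml.
by apply: eq_bigr => j _; rewrite mulrA.
Qed.

(** On [A] the quadratic form has matrix (alpha - gamma) Id + gamma times the all-ones matrix. *)
Lemma second_order_sum (h : I -> R) :
  \sum_j w j * (\sum_(i | A i) b j i * h i) ^+ 2 =
  (alpha - gamma) * (\sum_(i | A i) h i ^+ 2)
  + gamma * (\sum_(i | A i) h i) ^+ 2.
Proof.
transitivity (\sum_(i | A i) \sum_(i' | A i')
    h i * h i' * (if i == i' then alpha else gamma)).
  transitivity (\sum_j \sum_(i | A i) \sum_(i' | A i')
      h i * h i' * (w j * (b j i * b j i'))).
    apply: eq_bigr => j _; rewrite expr2 mulr_suml mulr_sumr.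
    apply: eq_bigr => i _; rewrite mulr_sumr mulr_sumr.
    by apply: eq_bigr => i' _; ring.
  rewrite exchange_big; apply: eq_bigr => i Ai.
  rewrite exchange_big; apply: eq_bigr => i' Ai'.
  by rewrite -mulr_sumr gammaE.
rewrite expr2 mulr_suml !mulr_sumr -big_split; apply: eq_bigr => i Ai /=.
rewrite (bigD1 i) //= eqxx [X in gamma * (_ * X)](bigD1 i) //=.
rewrite mulrDr mulrDr addrA; congr (_ + _); first by ring.
rewrite !mulr_sumr; apply: eq_bigr => i' /andP[_ ii'].
by rewrite eq_sym (negPf ii'); ring.
Qed.

Hypotheses (a_gt0 : 0 < a) (mu_ge0 : 0 <= mu).
Hypothesis curvature_gt0 :
  0 < a * (beta - alpha) + a ^+ 2 / 2%:R * mu * (alpha - gamma).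

(** With t the mass of h off [A], the sum is D0 t, D0 being the quantity of [curvature_gt0], up to
    errors of total size at most e C t. Every error has to be bounded by a multiple of e t, not
    merely of e^2. *)
Lemma exp_sum_local_min : exists2 e : R, 0 < e & forall h : I -> R,
  (forall i, `|h i| < e) -> h i0 = 0 -> (forall i, ~~ A i -> 0 <= h i) ->
  \sum_(i | A i) h i = - \sum_(i | ~~ A i) h i ->
  \sum_i h i ^+ 2 = mu * \sum_(i | ~~ A i) h i ->
  0 <= \sum_j w j * (expR (a * \sum_i b j i * h i) - 1).
Proof.
pose n : R := #|I|%:R; pose Wt := \sum_j `|w j|; pose E := expR (a * n).
have D0_gt0 := curvature_gt0; set D0 := (X in 0 < X) in D0_gt0.
(* The first term pays for replacing X^2 by Y^2 in the quadratic part, the second for the Taylor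
   remainder. *)
pose C2 := a ^+ 2 * n + a ^+ 3 * n ^+ 2 * mu * E.
pose C := a ^+ 2 / 2%:R * (`|alpha - gamma| + `|gamma| * n) + Wt * C2.
have n0 : 0 <= n by apply: ler0n.
have E0 : 0 <= E by apply: expR_ge0.
have W0 : 0 <= Wt by apply: sumr_ge0.
have a2 : 0 <= a ^+ 2 by apply: sqr_ge0.
have a3 : 0 <= a ^+ 3 by rewrite exprn_ge0 // ltW.
have a22 : 0 <= a ^+ 2 / 2%:R by rewrite divr_ge0.
have C20 : 0 <= C2.
  apply: addr_ge0 (mulr_ge0 a2 n0) _; apply: mulr_ge0 E0.
  exact: mulr_ge0 (mulr_ge0 a3 (exprn_ge0 2 n0)) mu_ge0.
have C0 : 0 <= C.
  apply: addr_ge0 (mulr_ge0 a22 _) (mulr_ge0 W0 C20).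
  exact: addr_ge0 (normr_ge0 _) (mulr_ge0 (normr_ge0 _) n0).
have eC : 0 < C + 1 by apply: ltr_wpDl.
(* The bound 1 keeps the exponentials below [E]; the other gives e C <= D0, with C + 1 avoiding a
   zero denominator. *)
exists (Num.min 1 (D0 / (C + 1))) => [|h]; first by rewrite lt_min ltr01 divr_gt0.
set e := Num.min _ _ => he h0 hT hA hS.
have e0 : 0 < e by rewrite /e lt_min ltr01 divr_gt0.
have e1 : e <= 1 by rewrite /e ge_min lexx.
have eD : e * C <= D0.
  have : e <= D0 / (C + 1) by rewrite /e ge_min lexx orbT.
  rewrite ler_pdivlMr // mulrDr mulr1 => H.
  by apply: le_trans H; rewrite lerDl ltW.
have he' i : `|h i| <= e by apply: ltW.
set t := \sum_(i | ~~ A i) h i in hA hS *.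
have t0 : 0 <= t by apply: sumr_ge0.
have tn : t <= n * e.
  rewrite /t big_mkcond /n mulr_natl -sumr_const; apply: ler_sum => i _.
  case: ifP => _; last exact: ltW.
  exact: le_trans (ler_norm _) (he' i).
pose X j := \sum_i b j i * h i.
pose Y j := \sum_(i | A i) b j i * h i.
pose Z j := \sum_(i | ~~ A i) b j i * h i.
have XYZ j : X j = Y j + Z j by rewrite /X (bigID A).
have Z0 j : 0 <= Z j.
  by apply: sumr_ge0 => i Ai; rewrite mulr_ge0 ?hT //; case/andP: (b01 j i).
have Zt j : Z j <= t.
  apply: ler_sum => i Ai; have /andP[_ b1] := b01 j i.
  by rewrite -[leRHS]mul1r ler_wpM2r ?hT.
have Xe j : `|X j| <= n * e by apply: norm_sum_indicator_le.
have Ye j : `|Y j| <= n * e by apply: norm_sum_indicator_le.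
(* Cauchy-Schwarz and the sphere equation: X^2 is of order t, so |X|^3 is of order e t. *)
have X2 j : X j ^+ 2 <= n * (mu * t).
  apply: le_trans (sqr_sum_le _) _; rewrite -hS ler_wpM2l //.
  apply: ler_sum => i _; have /andP[b0 b1] := b01 j i.
  by rewrite exprMn -[leRHS]mul1r ler_wpM2r ?sqr_ge0 // expr_le1.
have key j : `|(expR (a * X j) - 1) - (a * X j + a ^+ 2 / 2%:R * Y j ^+ 2)|
    <= C2 * (e * t).
  have T := expR_taylor2 _ (a * X j).
  have r1 : `|a * X j| ^+ 3 * expR `|a * X j| <=
      a ^+ 3 * n ^+ 2 * mu * E * (e * t).
    have EE : expR `|a * X j| <= E.
      rewrite ler_expR normrM gtr0_norm // ler_pM2l //.
      apply: le_trans (Xe j) _; rewrite -[leRHS]mulr1 ler_wpM2l //.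
    have P3 : `|a * X j| ^+ 3 <= a ^+ 3 * (n * e * (n * (mu * t))).
      rewrite normrM gtr0_norm // exprMn ler_wpM2l // exprS.
      by rewrite ler_pM // ?exprn_ge0 // -normrX ger0_norm ?sqr_ge0.
    apply: le_trans (ler_pM _ _ P3 EE) _; rewrite ?exprn_ge0 ?expR_ge0 //.
    by rewrite le_eqVlt; apply/orP; left; apply/eqP; ring.
  have r2 : `|X j ^+ 2 - Y j ^+ 2| <= t * (2%:R * (n * e)).
    rewrite subr_sqr normrM ler_pM //.
      by rewrite XYZ addrAC subrr add0r ger0_norm.
    apply: le_trans (ler_normD _ _) _.
    by have := Xe j; have := Ye j; lra.
  have -> : expR (a * X j) - 1 - (a * X j + a ^+ 2 / 2%:R * Y j ^+ 2) =
     (expR (a * X j) - (1 + a * X j + (a * X j) ^+ 2 / 2%:R))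
     + a ^+ 2 / 2%:R * (X j ^+ 2 - Y j ^+ 2) by field.
  apply: le_trans (ler_normD _ _) _.
  have r3 : `|a ^+ 2 / 2%:R * (X j ^+ 2 - Y j ^+ 2)| <= a ^+ 2 * n * (e * t).
    rewrite normrM ger0_norm ?divr_ge0 //.
    apply: le_trans (ler_wpM2l _ r2) _; first by rewrite divr_ge0.
    by rewrite le_eqVlt; apply/orP; left; apply/eqP; field.
  rewrite /C2 mulrDl addrC lerD //; exact: le_trans T r1.
have L : \sum_j w j * (expR (a * X j) - 1) =
    a * (\sum_j w j * X j) + a ^+ 2 / 2%:R * (\sum_j w j * Y j ^+ 2)
    + \sum_j w j *
      ((expR (a * X j) - 1) - (a * X j + a ^+ 2 / 2%:R * Y j ^+ 2)).
  rewrite !mulr_sumr -!big_split; apply: eq_bigr => j _ /=; ring.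
rewrite -/X L; clear L.
rewrite first_order_sum // second_order_sum hA -/t.
set rem := \sum_j w j * _.
have remB : - (Wt * (C2 * (e * t))) <= rem.
  rewrite lerNl; apply: le_trans (ler_norm _) _; rewrite normrN.
  apply: le_trans (ler_norm_sum _ _ _) _; rewrite mulr_suml.
  by apply: ler_sum => j _; rewrite normrM ler_wpM2l.
(* The squares on [A] sum to mu t minus the squares off [A]; the latter, being at most e t, count as
   error. *)
have := hS; rewrite (bigID A) /=; set SA := \sum_(i | A i) _; set ST := \sum_(i | ~~ A i) _.
move=> hS'; have -> : SA = mu * t - ST by rewrite -hS' addrK.
have ST0 : 0 <= ST by apply: sumr_ge0 => i _; apply: sqr_ge0.
have STe : ST <= e * t.
  rewrite /t mulr_sumr; apply: ler_sum => i Ai; rewrite expr2 ler_wpM2r ?hT //.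
  exact: le_trans (ler_norm _) (he' i).
have q1 : - (`|alpha - gamma| * (e * t)) <= - ((alpha - gamma) * ST).
  rewrite lerN2; apply: le_trans (ler_norm _) _.
  by rewrite normrM (ger0_norm ST0) ler_wpM2l.
have q2 : - (`|gamma| * (n * e * t)) <= gamma * (- t) ^+ 2.
  rewrite lerNl; apply: le_trans (ler_norm _) _.
  rewrite normrN normrM ler_wpM2l // sqrrN ger0_norm ?sqr_ge0 //.
  by rewrite expr2 ler_wpM2r.
have q3 : - (a ^+ 2 / 2%:R * (`|alpha - gamma| + `|gamma| * n)) * (e * t) <=
   a ^+ 2 / 2%:R * (gamma * (- t) ^+ 2 - (alpha - gamma) * ST).
  apply: le_trans (ler_wpM2l a22 (lerD q2 q1)).
  by rewrite le_eqVlt; apply/orP; left; apply/eqP; ring.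
have q4 : e * C * t <= D0 * t by rewrite ler_wpM2r.
have : 0 <= D0 * t - (a ^+ 2 / 2%:R * (`|alpha - gamma| + `|gamma| * n)) * (e * t)
     - Wt * (C2 * (e * t)).
  rewrite (_ : _ - _ = D0 * t - e * C * t) ?subr_ge0 // /C; ring.
move=> H; apply: le_trans H _; rewrite /D0.
have := lerD q3 remB; set u := a ^+ 2 / 2%:R.
rewrite -subr_ge0 => H; rewrite -subr_ge0; apply: le_trans H _.
by rewrite le_eqVlt; apply/orP; left; apply/eqP; ring.
Qed.

End SecondOrderMinimum.

(** * Binary expansions and the hyperplane of the lower half *)

Section BinaryExpansion.

Lemma bits_inj k (i i' : nat) : (i < 2 ^ k)%N -> (i' < 2 ^ k)%N ->
  (forall j, (j < k)%N -> odd (i %/ 2 ^ j) = odd (i' %/ 2 ^ j)) -> i = i'.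
Proof.
elim: k i i' => [|k IH] i i'; first by case: i i' => [|?] [|?].
move=> ik ik' H.
rewrite (divn_eq i 2) (divn_eq i' 2) !modn2.
have := H 0%N (ltn0Sn _); rewrite !divn1 => ->; congr (_ * 2 + _)%N.
apply: IH; rewrite ?ltn_divLR // -?expnSr // => j jk.
by have := H j.+1 jk; rewrite expnS !divnMA.
Qed.

Lemma nu_inj k : injective (fun i : 'I_(2 ^ k) => nu k i).
Proof.
move=> i i' /= H; apply: val_inj.
apply: (bits_inj k _ _ (ltn_ord i) (ltn_ord i')) => j jk; move/matrixP/(_ 0 (Ordinal jk)): H.
by rewrite !mxE /=; do 2!case: odd.
Qed.

Lemma nu_bij k : bijective (fun i : 'I_(2 ^ k) => nu k i).
Proof. by apply: inj_card_bij (@nu_inj k) _; rewrite card_mx card_Fp // card_ord mul1n. Qed.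

Lemma nu_eq0 k (i : 'I_(2 ^ k)) : (nu k i == 0) = (val i == 0%N).
Proof.
have nu0 : nu k 0 = 0 by apply/matrixP => x y; rewrite !mxE div0n.
apply/eqP/eqP => [H|->] //.
have := @nu_inj k i (Ordinal (expn_gt0 2 k)).
by rewrite /= H nu0 => /(_ erefl) ->.
Qed.

Definition last_coord (N : nat) : 'cV['F_2]_N.+1 := delta_mx ord_max 0.

Lemma rank_ker_last_coord N : \rank (kermx (last_coord N)) = N.
Proof. by rewrite mxrank_ker mxrank_delta subn1. Qed.

(** [last_coord] reads off the last column of [nu], which holds the top bit i / 2^N, either 0 or
    1. *)
Lemma nu_hyperplane N (i : 'I_(2 ^ N.+1)) :
  (nu N.+1 i \in rowg (kermx (last_coord N))) = (val i < 2 ^ N)%N.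
Proof.
rewrite mem_rowg; have -> : (nu N.+1 i <= kermx (last_coord N))%MS =
    (nu N.+1 i 0 ord_max == 0).
  apply/sub_kermxP/eqP => [/matrixP/(_ 0 0)|H].
    by rewrite -colE !mxE.
  by apply/matrixP => x y; rewrite !ord1 -colE mxE H mxE.
rewrite mxE /=.
have lt2 : (i %/ 2 ^ N < 2)%N by rewrite ltn_divLR ?expn_gt0 // -expnS.
case: (ltnP i (2 ^ N)) => iN; first by rewrite divn_small.
have ge1 : (0 < i %/ 2 ^ N)%N by rewrite divn_gt0 ?expn_gt0.
by have -> : (i %/ 2 ^ N = 1)%N by apply/eqP; rewrite eqn_leq -ltnS lt2.
Qed.

End BinaryExpansion.

(** * The loss near [qcheck] and its coefficients *)

Section LossExpansion.
Variables (R : realType) (N : nat).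
Local Notation k := N.+2.
Local Notation H := (rowg (kermx (last_coord N.+1))).
Implicit Types S : {set 'rV['F_2]_k}.

(** If S is not inside H, it has 2^(k-d-1) vectors outside H, each of mass 2^(1-k). *)
Lemma zeta_qcheck d S : S \in Xi k (k - d) -> (d <= k)%N ->
  zeta S (@qcheck R k) = if S \subset H then 0 else 2%:R^-1 ^+ d.
Proof.
move=> SX dk; rewrite /zeta /qcheck subn1 /=.
transitivity (\sum_(i < 2 ^ k | nu k i \in S :\: H) (2%:R ^+ N.+1)^-1 : R).
  rewrite big_mkcond [RHS]big_mkcond; apply: eq_bigr => i _.
  rewrite finset.in_setD nu_hyperplane andbC.
  by case: (nu k i \in S) => //=; case: ltnP.
rewrite -(reindex (fun i : 'I_(2 ^ k) => nu k i) (P := mem (S :\: H))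
  (F := fun=> (2%:R ^+ N.+1)^-1)); last exact: onW_bij (nu_bij k).
rewrite sumr_const; case: ifPn => SH.
  move: SH; rewrite -finset.setD_eq0 => /eqP ->; rewrite cards0 mulr0n //.
rewrite (card_Xi_setD_hyperplane k _ _ _ SX SH).
(* For d = k, S is the zero space, which lies in H. *)
have dk' : (d < k)%N.
  rewrite ltn_neqAle dk andbT; apply: contraNneq SH => dE.
  move: SX; rewrite dE subnn => /XiP[A /eqP]; rewrite mxrank_eq0 => /eqP -> ->.
  by rewrite rowgS sub0mx.
rewrite -[_ *+ (2 ^ _)]mulr_natr natrX.
have : (N.+1 = d + (k - d).-1)%N by lia.
move: (k - d).-1 => r ->.
have p0 n : 2%:R ^+ n != 0 :> R by rewrite expf_neq0 // pnatr_eq0.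
by rewrite exprD invfM mulfVK // exprVn.
Qed.

(** Merges the double sum of [loss] into one sum over all sets, as [exp_sum_local_min] expects; only
    proper subspaces get nonzero weight. *)
Definition Kset S : R :=
  \sum_(1 <= d < k.+1) Kc R d * (S \in Xi k (k - d))%:R.

Lemma sum_Kset (F : {set 'rV['F_2]_k} -> R) :
  \sum_S Kset S * F S =
  \sum_(1 <= d < k.+1) Kc R d * \sum_(S in Xi k (k - d)) F S.
Proof.
under eq_bigr do rewrite /Kset mulr_suml.
rewrite exchange_big; apply: eq_bigr => d _.
rewrite [X in _ * X]big_mkcond mulr_sumr; apply: eq_bigr => S _ /=.
by case: (S \in _); rewrite ?mulr1 ?mulr0 ?mul0r.
Qed.

Lemma zeta_indicator S (q : 'I_(2 ^ k) -> R) :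
  zeta S q = \sum_(i < 2 ^ k) (nu k i \in S)%:R * q i.
Proof.
rewrite /zeta big_mkcond; apply: eq_bigr => i _.
by case: (nu k i \in S); rewrite ?mul1r ?mul0r.
Qed.

Definition weight (a : R) S : R := Kset S * expR (a * zeta S (@qcheck R k)).

(** The affine part cancels, eps^(n(1-z)) = e^(-a) e^(a z), and [zeta] is additive in q. *)
Lemma loss_sub n (eps : R) (q q' : 'I_(2 ^ k) -> R) : 0 < eps ->
  let a := - (n%:R * ln eps) in
  loss n eps q' - loss n eps q =
  expR (- a) * \sum_S Kset S * expR (a * zeta S q) *
     (expR (a * zeta S (fun i => q' i - q i)) - 1).
Proof.
move=> eps0 a; rewrite /loss -!sum_Kset [_ + \sum_(S : {set _}) _]addrC addrKA.
rewrite -sumrB mulr_sumr; apply: eq_bigr => S _.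
have zB : zeta S q' = zeta S q + zeta S (fun i => q' i - q i).
  rewrite !zeta_indicator -big_split; apply: eq_bigr => i _ /=; ring.
have pE z : eps `^ (n%:R * (1 - z)) = expR (- a) * expR (a * z).
  rewrite /powR gt_eqF // -expRD; congr expR; rewrite /a; ring.
rewrite !pE zB mulrDr expRD; ring.
Qed.

(* The zero-dimensional subspace contributes nothing as soon as [F] charges
   only subspaces containing a given nonzero vector. *)
Lemma sum_weight a (F : {set 'rV['F_2]_k} -> R) (v : 'rV['F_2]_k) :
  v != 0 -> (forall S, v \notin S -> F S = 0) ->
  \sum_S weight a S * F S =
  \sum_(j < N.+1) Kc R j.+1 * \sum_(S in Xi k (N - j).+1)
    (if S \subset H then 1 else expR (a * 2%:R^-1 ^+ j.+1)) * F S.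
Proof.
move=> v0 F0; under eq_bigr do rewrite /weight -mulrA.
rewrite (sum_Kset (fun S => expR (a * zeta S (@qcheck R k)) * F S)).
rewrite big_add1 /= big_mkord big_ord_recr /= subnn.
rewrite [X in _ + _ * X]big1 ?mulr0 ?addr0; last first.
  move=> S /XiP[A /eqP]; rewrite mxrank_eq0 => /eqP -> SE.
  by rewrite F0 ?mulr0 // SE mem_rowg submx0.
apply: eq_bigr => j _; congr (_ * _).
have jN : (j <= N)%N by rewrite -ltnS.
have kj : (k - j.+1 = (N - j).+1)%N by rewrite subSS subSn.
rewrite kj; apply: eq_bigr => S SX; rewrite (zeta_qcheck j.+1).
- by case: ifP => // _; rewrite mulr0 expR0.
- by rewrite kj.
- by rewrite ltnS leqW.
Qed.

(** Closed forms of the alpha, beta and gamma above, with j = d - 1. In [betaN] the subspaces inside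
    H, counted by [gbin R N (N - j)], carry exponential factor 1; in [gammaN] the lines, j = N,
    contribute 0. *)
Definition alphaN (a : R) : R := \sum_(j < N.+1)
  Kc R j.+1 * (expR (a * 2%:R^-1 ^+ j.+1) * gbin R N.+1 (N - j)).
Definition betaN (a : R) : R := \sum_(j < N.+1)
  Kc R j.+1 * (expR (a * 2%:R^-1 ^+ j.+1)
                 * (gbin R N.+1 (N - j) - gbin R N (N - j)) + gbin R N (N - j)).
Definition gammaN (a : R) : R := \sum_(j < N.+1)
  Kc R j.+1 * (expR (a * 2%:R^-1 ^+ j.+1) *
                 if (j < N)%N then gbin R N (N - j).-1 else 0).

Lemma sum_Xi_mem d (P : pred {set 'rV['F_2]_k}) :
  \sum_(S in Xi k d) (P S)%:R = #|[set S in Xi k d | P S]|%:R :> R.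
Proof.
rewrite -natr_sum -big_mkcondr sum1_card; congr (_%:R).
by apply: eq_card => S; rewrite finset.in_set unfold_in.
Qed.

Lemma notin_hyperplane_neq0 (v : 'rV['F_2]_k) : v \notin H -> v != 0.
Proof. by apply: contraNneq => ->; rewrite mem_rowg sub0mx. Qed.

Lemma not_sub_hyperplane S v : v \in S -> v \notin H -> (S \subset H) = false.
Proof.
by move=> vS vH; apply/negP => /fintype.subsetP/(_ _ vS); apply/negP.
Qed.

Lemma alphaNE a v : v \notin H ->
  \sum_S weight a S * (v \in S)%:R = alphaN a.
Proof.
move=> vH; have v0 := notin_hyperplane_neq0 _ vH.
rewrite (sum_weight a (fun S => (v \in S)%:R) _ v0) => [|S /negPf -> //].
apply: eq_bigr => j _; congr (_ * _).
rewrite -(card_Xi_mem k R (N - j).+1 _ v0) // -sum_Xi_mem mulr_sumr.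
apply: eq_bigr => S _; case: (boolP (v \in S)) => vS; last by rewrite !mulr0.
by rewrite (not_sub_hyperplane _ _ vS).
Qed.

Lemma gammaNE a v v' : v \notin H -> v' \notin H -> v != v' ->
  \sum_S weight a S * ((v \in S)%:R * (v' \in S)%:R) = gammaN a.
Proof.
move=> vH vH' vv'; have v0 := notin_hyperplane_neq0 _ vH.
have v0' := notin_hyperplane_neq0 _ vH'.
rewrite (sum_weight a (fun S => (v \in S)%:R * (v' \in S)%:R) _ v0); last first.
  by move=> S /negPf ->; rewrite mul0r.
apply: eq_bigr => j _; congr (_ * _).
have -> : (if (j < N)%N then gbin R N (N - j).-1 else 0) =
    #|[set S in Xi k (N - j).+1 | (v \in S) && (v' \in S)]|%:R.
  by rewrite card_Xi_mem2 // ltnS subn_gt0 !subSS subn0 subn1.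
rewrite -(sum_Xi_mem _ (fun S => (v \in S) && (v' \in S))) mulr_sumr.
apply: eq_bigr => S _; case: (boolP (v \in S)) => vS; last by rewrite mul0r !mulr0.
by rewrite (not_sub_hyperplane _ _ vS) // mul1r.
Qed.

Lemma betaNE a v : v \in H -> v != 0 ->
  \sum_S weight a S * (v \in S)%:R = betaN a.
Proof.
move=> vH v0.
rewrite (sum_weight a (fun S => (v \in S)%:R) _ v0) => [|S /negPf -> //].
apply: eq_bigr => j _; congr (_ * _); set x := expR _.
have vK : (v <= kermx (last_coord N.+1))%MS by rewrite -mem_rowg.
rewrite -(card_Xi_mem k R (N - j).+1 _ v0) //.
have := card_Xi_mem_sub k R (N - j).+1 _ v _ v0 vK (ltn0Sn _).
rewrite rank_ker_last_coord /= => <-.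
rewrite -sum_Xi_mem -(sum_Xi_mem _ (fun S => (v \in S) && (S \subset H))).
rewrite -sumrB mulr_sumr -big_split; apply: eq_bigr => S _ /=.
by case: (v \in S); case: (S \subset H) => /=; ring.
Qed.

(** Equality with a times the sum of [alternating_exp_sum_gt0] holds for each j: with x the
    exponential, beta - alpha gives the factor 1 - x, and alpha - gamma gives 2^(N-j) x by
    [gbin_pascal]. *)
Lemma curvature_gt0 a : 0 < a ->
  0 < a * (betaN a - alphaN a)
      + a ^+ 2 / 2%:R * (2%:R / 2%:R ^+ N.+1) * (alphaN a - gammaN a).
Proof.
move=> a0; have := mulr_gt0 a0 (alternating_exp_sum_gt0 R N _ a0).
congr (0 < _); rewrite /betaN /alphaN /gammaN -!sumrB !mulr_sumr -big_split.
apply: eq_bigr => j _ /=; have jN : (j <= N)%N by rewrite -ltnS.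
rewrite -(Kc_gbin _ _ _ jN); set x := expR _; set K := Kc R _.
have P : gbin R N.+1 (N - j) - (if (j < N)%N then gbin R N (N - j).-1 else 0) =
    2%:R ^+ (N - j) * gbin R N (N - j).
  case: ltnP => [lt|ge]; last by rewrite (eqP ge) !gbin0 expr0; ring.
  have -> : (N - j = (N - j).-1.+1)%N by rewrite prednK // subn_gt0.
  by rewrite gbin_pascal //= (leq_trans (leq_pred _)) // leq_subr.
have Q : 2%:R ^+ N.+1 = 2%:R ^+ j.+1 * 2%:R ^+ (N - j) :> R.
  by rewrite -exprD addSn subnKC.
set g := (if _ then _ else _) in P *; have -> : g = gbin R N.+1 (N - j) -
  2%:R ^+ (N - j) * gbin R N (N - j) by rewrite -P; ring.
rewrite Q exprVn.
have p0 n : 2%:R ^+ n != 0 :> R by rewrite expf_neq0 // pnatr_eq0.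
have := p0 j.+1; have := p0 (N - j)%N.
by move: (2%:R ^+ j.+1) (2%:R ^+ (N - j)) => y z z0 y0; field; rewrite y0 z0.
Qed.

End LossExpansion.

(** * The radius condition in terms of the sum of squares *)

Section Sphere.
Variables (R : realType) (N : nat).
Local Notation k := N.+2.
Local Notation m := (2%:R ^+ N.+1 : R).

Lemma pow2_gt0 n : 0 < 2%:R ^+ n :> R.
Proof. by rewrite exprn_gt0 // ltr0n. Qed.

Lemma qcheckE i : @qcheck R k i = if (val i < 2 ^ N.+1)%N then 0 else m^-1.
Proof. by rewrite /qcheck subn1. Qed.

Lemma sum_upper_half (x : R) :
  \sum_(i < 2 ^ k) (if (val i < 2 ^ N.+1)%N then 0 else x) = m * x.
Proof.
pose F i : R := if (i < 2 ^ N.+1)%N then 0 else x.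
rewrite -(big_mkord xpredT F) (@big_cat_nat _ _ _ (2 ^ N.+1)) ?leq_exp2l //=.
rewrite big_nat_cond big1 ?add0r; last first.
  by move=> i /andP[/andP[_ iM] _]; rewrite /F iM.
rewrite (_ : \sum_(_ <= i < _) _ = \sum_(2 ^ N.+1 <= i < 2 ^ k) x); last first.
  apply: eq_big_nat.
  by move=> i /andP[iM _]; rewrite /F ltnNge iM.
rewrite sumr_const_nat expnS mul2n -addnn addnK -natrX mulr_natl //.
Qed.

(** With c = 1/(2^k - 1), the cross terms give -2c and the 2^k - 1 constant terms give c. *)
Lemma sphere_sum (q : 'I_(2 ^ k) -> R) :
  (forall i, val i = 0%N -> q i = 0) -> \sum_i q i = 1 ->
  \sum_(i < 2 ^ k | (0 < val i)%N) (q i - (2%:R ^+ k - 1)^-1) ^+ 2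
  = \sum_i q i ^+ 2 - (2%:R ^+ k - 1)^-1.
Proof.
move=> q0 q1; set c := _^-1.
have nz : 2%:R ^+ k - 1 != 0 :> R by apply: expr2S_sub1_neq0.
have {}q0 : q (Ordinal (expn_gt0 2 k)) = 0 by apply: q0.
have zE (i : 'I_(2 ^ k)) : (0 < val i)%N = (i != Ordinal (expn_gt0 2 k)).
  by rewrite lt0n.
have s1 : \sum_(i < 2 ^ k | (0 < val i)%N) q i = 1.
  rewrite -q1 [RHS](bigD1 (Ordinal (expn_gt0 2 k))) //= q0 add0r.
  exact: eq_bigl.
have s2 : \sum_(i < 2 ^ k | (0 < val i)%N) q i ^+ 2 = \sum_i q i ^+ 2.
  rewrite [RHS](bigD1 (Ordinal (expn_gt0 2 k))) //= q0 expr0n add0r.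
  exact: eq_bigl.
have s3 : \sum_(i < 2 ^ k | (0 < val i)%N) c ^+ 2 = c.
  rewrite (eq_bigl _ _ zE).
  have : \sum_(i < 2 ^ k) c ^+ 2 = 2%:R ^+ k * c ^+ 2.
    by rewrite sumr_const card_ord -natrX mulr_natl.
  rewrite (bigD1 (Ordinal (expn_gt0 2 k))) //= => H.
  have cE : (2%:R ^+ k - 1) * c = 1 by rewrite mulfV.
  transitivity ((2%:R ^+ k - 1) * c * c); last by rewrite cE mul1r.
  by apply: (addrI (c ^+ 2)); rewrite H; ring.
transitivity (\sum_(i < 2 ^ k | (0 < val i)%N)
    (q i ^+ 2 + ((- (2%:R * c)) * q i + c ^+ 2))).
  by apply: eq_bigr => i _; ring.
by rewrite !big_split /= -mulr_sumr s1 s2 s3; ring.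
Qed.

Lemma CrhoP (q : 'I_(2 ^ k) -> R) : Crho q <->
  [/\ forall i, val i = 0%N -> q i = 0, forall i, 0 <= q i,
      \sum_i q i = 1 & \sum_i q i ^+ 2 = m^-1].
Proof.
have m0 : m != 0 by rewrite gt_eqF // pow2_gt0.
have c0 : 2%:R * m - 1 != 0 by rewrite -exprS; apply: expr2S_sub1_neq0.
have rE : (2%:R ^+ (k - 1) - 1) / ((2%:R ^+ k - 2%:R ^+ (k - 1)) * (2%:R ^+ k - 1))
   = m^-1 - (2%:R ^+ k - 1)^-1 :> R.
  rewrite subn1 /= [2%:R ^+ k]exprS.
  have -> : 2%:R * m - m = m by ring.
  by field; rewrite m0 c0.
have r0 : 0 <= m^-1 - (2%:R ^+ k - 1)^-1 :> R.
  have m1 : 1 < m by rewrite exprn_egt1 // ltr1n.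
  rewrite subr_ge0 lef_pV2 ?posrE ?pow2_gt0 // [2%:R ^+ k]exprS; lra.
split=> -[q0 qp q1 qS]; split=> //.
  move: qS; rewrite (sphere_sum _ q0 q1) rE => /eqP; rewrite eqr_sqrt //.
    by move=> /eqP/addIr.
  by rewrite -(sphere_sum _ q0 q1) sumr_ge0 // => i _; apply: sqr_ge0.
by rewrite (sphere_sum _ q0 q1) rE qS.
Qed.

Lemma Crho_qcheck : Crho (@qcheck R k).
Proof.
have m0 := pow2_gt0 N.+1; apply/CrhoP; split=> [i i0|i||].
- by rewrite qcheckE i0 expn_gt0.
- by rewrite qcheckE; case: ifP => // _; rewrite invr_ge0 ltW.
- under eq_bigr do rewrite qcheckE.
  by rewrite sum_upper_half mulfV // gt_eqF.
transitivity (\sum_(i < 2 ^ k) if (val i < 2 ^ N.+1)%N then 0 else m^-1 ^+ 2).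
  by apply: eq_bigr => i _; rewrite qcheckE; case: ifP => // _; rewrite expr0n.
by rewrite sum_upper_half expr2 mulrA mulfV ?mul1r // gt_eqF.
Qed.

(** Both vectors have squared norm 1/m, and their inner product is 1/m times the mass of q off the
    lower half, where [qcheck] vanishes. This is the source of mu = 2/m. *)
Lemma sphere_defect (q : 'I_(2 ^ k) -> R) : Crho q ->
  \sum_i (q i - @qcheck R k i) ^+ 2 =
  2%:R / m * \sum_(i < 2 ^ k | (val i < 2 ^ N.+1)%N) (q i - @qcheck R k i).
Proof.
move=> /CrhoP[_ _ q1 qS]; have /CrhoP[_ _ _ cS] := Crho_qcheck.
have cross : \sum_i q i * @qcheck R k i =
    m^-1 * (1 - \sum_(i < 2 ^ k | (val i < 2 ^ N.+1)%N) q i).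
  rewrite -[X in _ * (X - _)]q1 [in RHS](bigID (fun i : 'I_(2 ^ k) => (val i < 2 ^ N.+1)%N)) /=.
  rewrite addrAC subrr add0r mulr_sumr [RHS]big_mkcond.
  apply: eq_bigr => i _ /=; rewrite qcheckE.
  by case: (val i < _)%N => /=; rewrite ?mulr0 // mulrC.
rewrite [X in _ * X](eq_bigr q); last by move=> i iM; rewrite qcheckE iM subr0.
transitivity (\sum_i q i ^+ 2 + \sum_i @qcheck R k i ^+ 2
    - 2%:R * \sum_i q i * @qcheck R k i).
  rewrite mulr_sumr -sumrN -!big_split.
  by apply: eq_bigr => i _ /=; ring.
by rewrite qS cS cross; field; rewrite gt_eqF // pow2_gt0.
Qed.

End Sphere.

(** * Local minimality of [qcheck] *)

Theorem theorem4 (R : realType) (k n : nat) (eps : R) :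
  (2 <= k)%N -> (1 <= n)%N -> 0 < eps < 1 ->
  Crho (@qcheck R k) /\
  local_minimizer (loss n eps) (@Crho R k) (@qcheck R k).
Proof.
case: k => [|[|N]] // _ n1 eps01; have eps0 := proj1 (andP eps01).
split; first exact: Crho_qcheck.
split; first exact: Crho_qcheck.
pose a : R := - (n%:R * ln eps).
have a0 : 0 < a by rewrite oppr_gt0 pmulr_rlt0 ?ltr0n // ln_lt0.
pose b (S : {set 'rV['F_2]_N.+2}) (i : 'I_(2 ^ N.+2)) : R := (nu N.+2 i \in S)%:R.
pose A (i : 'I_(2 ^ N.+2)) := ~~ (val i < 2 ^ N.+1)%N.
pose i0 : 'I_(2 ^ N.+2) := Ordinal (expn_gt0 2 N.+2).
have b01 S i : 0 <= b S i <= 1 by rewrite /b; case: (_ \in _); rewrite ?lexx ?ler01.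
have alphaE i : A i -> \sum_S weight R N a S * b S i = alphaN R N a.
  by move=> Ai; rewrite alphaNE // nu_hyperplane.
have betaE i : ~~ A i -> i != i0 -> \sum_S weight R N a S * b S i = betaN R N a.
  by rewrite negbK => Ai ii0; rewrite betaNE ?nu_hyperplane ?nu_eq0.
have gammaE i i' : A i -> A i' -> \sum_S weight R N a S * (b S i * b S i')
    = if i == i' then alphaN R N a else gammaN R N a.
  move=> Ai Ai'; case: eqVneq => [<-|ii'].
    (* Incidences are 0 or 1, hence idempotent, so the diagonal value is [alphaN]. *)
    rewrite -(alphaE _ Ai); apply: eq_bigr => S _.
    by rewrite /b; case: (_ \in _); rewrite ?mulr1 ?mulr0.
  rewrite gammaNE ?nu_hyperplane //.
  by apply: contraNneq ii' => /nu_inj ->.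
have mu0 : 0 <= 2%:R / 2%:R ^+ N.+1 :> R by rewrite divr_ge0 // ltW ?pow2_gt0.
have [e e0 He] := exp_sum_local_min _ _ _ b _ A b01 _ _ _ a _ i0 alphaE betaE
  gammaE a0 mu0 (curvature_gt0 R N a a0).
exists e => // q Cq qe; rewrite -subr_ge0 loss_sub // -/a.
rewrite mulr_ge0 ?expR_ge0 //.
have /CrhoP[q0 qp q1 _] := Cq; have /CrhoP[c0 _ c1 _] := Crho_qcheck R N.
have lowE (F : 'I_(2 ^ N.+2) -> R) :
    \sum_(i | ~~ A i) F i = \sum_(i < 2 ^ N.+2 | (val i < 2 ^ N.+1)%N) F i.
  by apply: eq_bigl => i; rewrite negbK.
rewrite (eq_bigr (fun S => weight R N a S *
    (expR (a * \sum_i b S i * (q i - @qcheck R N.+2 i)) - 1))); last first.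
  by move=> S _; rewrite (zeta_indicator R N S (fun i => q i - @qcheck R N.+2 i)).
apply: (He (fun i => q i - @qcheck R N.+2 i)) => //.
- by rewrite q0 // c0 // subrr.
- by move=> i; rewrite negbK => iM; rewrite qcheckE iM subr0.
(* Both vectors have total mass 1, so the perturbation sums to 0. *)
- have : \sum_i (q i - @qcheck R N.+2 i) = 0 by rewrite sumrB q1 c1 subrr.
  by rewrite (bigID A) /= => /eqP; rewrite addr_eq0 => /eqP.
- by rewrite sphere_defect // lowE.
Qed.
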